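(* Let $\mathbb{Y}$ be a subspace of $\ell_1^n$ and let $\mathcal{A}=\{\widetilde{a_1},\ldots,\widetilde{a_m}\}$, $m\ge1$, be a basis of $\mathbb{Y}$ with $|\mathcal{Z}_{\mathcal{A}}|=r>0$. Then $\mathbb{Y}$ is not a co-Chebyshev subspace of $\ell_1^n$.
   Context: $\ell_1^n$ is $\mathbb{R}^n$ with the norm $\sum_i|x_i|$. For a linearly independent set $\mathcal{A}=\{\widetilde{a_1},\ldots,\widetilde{a_m}\}$ in $\ell_1^n$ with $\widetilde{a_k}=(a^k_1,\ldots,a^k_n)$, the zero set is $\mathcal{Z}_{\mathcal{A}}=\{i\in\{1,\ldots,n\}:(a_i^1,\ldots,a_i^m)=(0,\ldots,0)\}$. An element $y_0\in\mathbb{Y}$ is a best coapproximation to $x$ out of $\mathbb{Y}$ if $\|y_0-y\|\le\|x-y\|$ for all $y\in\mathbb{Y}$. A subspace $\mathbb{Y}$ of a Banach space $\mathbb{X}$ is coproximinal if every $x\in\mathbb{X}$ has a best coapproximation out of $\mathbb{Y}$, and co-Chebyshev if it is coproximinal and the best coapproximation out of $\mathbb{Y}$ is unique for each $x\in\mathbb{X}$. *)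

(* Defs.v *)
From HB Require Import structures.
From mathcomp Require Import all_boot all_order all_algebra.
From mathcomp Require Import reals.
Set Implicit Arguments.
Unset Strict Implicit.
Unset Printing Implicit Defensive.
Import Order.TTheory GRing.Theory Num.Theory.
Local Open Scope ring_scope.

(* An alias of 'rV[R]_n, because MathComp-Analysis puts the sup norm on
   matrices. *)
Definition ell1 (R : realType) (n : nat) : Type := 'rV[R]_n.

Section Ell1.
Variables (R : realType) (n : nat).

HB.instance Definition _ := Vector.copy (ell1 R n) 'rV[R]_n.

Definition ell1_norm (x : ell1 R n) : R := \sum_(i < n) `|x 0 i|.

Lemma ell1_normD (x y : ell1 R n) :
  ell1_norm (x + y) <= ell1_norm x + ell1_norm y.
Proof.
rewrite /ell1_norm -big_split /=; apply: ler_sum => i _.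
by rewrite mxE ler_normD.
Qed.

Lemma ell1_norm0_eq0 (x : ell1 R n) : ell1_norm x = 0 -> x = 0.
Proof.
move=> /eqP; rewrite psumr_eq0 // => /allP x0.
apply/rowP => i; rewrite [RHS]mxE.
by have := x0 i (mem_index_enum i); rewrite normr_eq0 => /eqP.
Qed.

Lemma ell1_normMn (x : ell1 R n) k : ell1_norm (x *+ k) = ell1_norm x *+ k.
Proof.
rewrite /ell1_norm -sumrMnl; apply: eq_bigr => i _.
by rewrite mulmxnE normrMn.
Qed.

Lemma ell1_normN (x : ell1 R n) : ell1_norm (- x) = ell1_norm x.
Proof. by apply: eq_bigr => i _; rewrite mxE normrN. Qed.

HB.instance Definition _ := Num.Zmodule_isNormed.Build R (ell1 R n)
  ell1_normD ell1_norm0_eq0 ell1_normMn ell1_normN.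

Lemma ell1_normE (x : ell1 R n) : `|x| = \sum_(i < n) `|x 0 i|.
Proof. by []. Qed.

Definition zero_set m (A : m.-tuple (ell1 R n)) : {set 'I_n} :=
  [set i | \row_(k < m) (tnth A k) 0 i == 0].

End Ell1.

Section Coapproximation.
Variables (R : realType) (V : normedZmodType R) (Y : {pred V}).

Definition best_coapproximation (x y0 : V) : Prop :=
  y0 \in Y /\ forall y, y \in Y -> `|y0 - y| <= `|x - y|.

Definition coproximinal : Prop := forall x, exists y0, best_coapproximation x y0.

Definition co_Chebyshev : Prop :=
  coproximinal /\
  forall x y1 y2,
    best_coapproximation x y1 -> best_coapproximation x y2 -> y1 = y2.

End Coapproximation.

(* Main.v *)
(* Every y in Y vanishes at some coordinate i. For x = c e_i with c >= 0 one has
   |x - y| = c + |y|, so by the triangle inequality each y0 in Y with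
   |y0| <= c is a best coapproximation to x; for c = |a| with a nonzero in Y,
   both 0 and a are. *)
Require Import Defs.
From HB Require Import structures.
From mathcomp Require Import all_boot all_order all_algebra.
From mathcomp Require Import reals.
Set Implicit Arguments.
Unset Strict Implicit.
Unset Printing Implicit Defensive.
Import Order.TTheory GRing.Theory Num.Theory.
Local Open Scope ring_scope.

(** Coordinate [i] is a linear functional that kills every vector of [A], hence all their
    combinations. *)
Lemma zero_set_span (R : realType) (n m : nat) (A : m.-tuple (ell1 R n))
    (i : 'I_n) (y : ell1 R n) :
  i \in zero_set A -> y \in <<A>>%VS -> y 0 i = 0.
Proof.
rewrite inE => /eqP A0 /coord_span ->.
rewrite summxE big1 // => k _.
by move/rowP: A0 => /(_ k); rewrite !mxE (tnth_nth 0) => ->; rewrite mulr0.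
Qed.

(** The two vectors have disjoint supports, and the sum norm is additive on such pairs. *)
Lemma ell1_norm_delta_sub (R : realType) (n : nat) (i : 'I_n) (c : R)
    (y : ell1 R n) :
  y 0 i = 0 -> `|(c *: delta_mx 0 i : ell1 R n) - y| = `|c| + `|y|.
Proof.
move=> yi0; rewrite !ell1_normE (bigD1 i) //= [in RHS](bigD1 i) //=.
rewrite !mxE yi0 !eqxx mulr1 subr0 normr0 add0r; congr (_ + _).
apply: eq_bigr => j /negPf ji.
by rewrite !mxE ji mulr0 sub0r normrN.
Qed.

Lemma best_coapproximation_delta (R : realType) (n : nat)
    (Y : {vspace ell1 R n}) (i : 'I_n) (c : R) (y0 : ell1 R n) :
  (forall y, y \in Y -> y 0 i = 0) -> y0 \in Y -> `|y0| <= c ->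
  best_coapproximation Y (c *: delta_mx 0 i : ell1 R n) y0.
Proof.
move=> Yi0 y0Y y0c; split=> // y /Yi0 /ell1_norm_delta_sub ->.
(* The distance from [x] to [y] is now [|c| + |y|]; cancelling [|y|] leaves [|y0| <= |c|]. *)
apply: le_trans (ler_normB _ _) _; rewrite lerD2r.
exact: le_trans y0c (ler_norm c).
Qed.

Theorem theorem2p22 (R : realType) (n m r : nat)
    (Y : {vspace ell1 R n}) (A : m.-tuple (ell1 R n)) :
  (1 <= m)%N ->
  basis_of Y A ->
  #|zero_set A| = r ->
  (0 < r)%N ->
  ~ co_Chebyshev Y.
Proof.
move=> m_gt0 /andP[/eqP spanA freeA] <- /card_gt0P[i iZ] [_ uniqY].
have Yi0 y : y \in Y -> y 0 i = 0 by rewrite -spanA; exact: zero_set_span.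
(* The first basis vector exists as [m >= 1] and is nonzero by freeness. *)
pose a := tnth A (Ordinal m_gt0).
have aA : a \in (A : seq _) by exact: mem_tnth.
have aY : a \in Y by rewrite -spanA memv_span.
have a_neq0 : a != 0 by exact: free_not0 freeA aA.
(* The scale [|a|] is the least [c] that the lemma allows for [a]; it also allows 0. *)
have a_best := best_coapproximation_delta Yi0 aY (lexx `|a|).
have zero_best : best_coapproximation Y (`|a| *: delta_mx 0 i : ell1 R n) 0.
  by apply: best_coapproximation_delta; rewrite ?mem0v ?normr0.
by move/eqP: a_neq0; apply; exact: uniqY a_best zero_best.
Qed.
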